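(* Let $K\in\mathbb{N}$, let $M$ be a first-order structure, and let $X$ be a $K$-approximate subring definable in $M$. Put $Y:=4X+X\cdot 4X$. If $\mathrm{Th}(M)$ has NSOP, then either there is a definable (in $M$) thick subset $D$ of $Y$ consisting of zero divisors, or $Y$ is a subring (additively $K^{11}$-commensurable with $X$).
   Context: Rings are associative but not necessarily commutative or unital. For subsets $Y,Z$ of a ring, $Y+Z=\{y+z\}$, $Y\cdot Z=\{yz\}$ ($y\in Y,z\in Z$), and $nZ$ is the set of sums of $n$ elements of $Z$. A subset $X$ of a ring is a $K$-approximate subring if it is additively symmetric ($0\in X$, $X=-X$) and $(X\cdot X)\cup(X+X)$ is covered by $K$ additive translates of $X$. Recursively, $X_0=X$, $X_{n+1}=X_n+X_n+X_n\cdot X_n$; $\bigcup_n X_n$ is the subring $\langle X\rangle$ generated by $X$. $X$ is definable in $M$ if all the sets $X_n$ are definable in $M$ (with parameters) and the restrictions of $+$ and $\cdot$ to each $X_n$ are definable in $M$. A subset $D\subseteq Y$ is a thick subset of $Y$ if $D$ is additively symmetric and there is a positive integer $N$ such that for all $r_0,\dots,r_{N-1}\in Y$ there are $i<j<N$ with $r_i-r_j\in D$. Zero divisors are taken in the ring $\langle X\rangle$: $d$ is a zero divisor if $dx=0$ or $xd=0$ for some nonzero $x$ (so $0$ counts as a zero divisor in a nonzero ring). Two sets are additively $N$-commensurable if each is covered by $N$ additive translates of the other. A complete theory $T$ has the strict order property (SOP) if there are a formula $\varphi(x,y)$ and a model $N$ of $T$ with a sequence $(a_i)_{i<\omega}$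 of parameters in $N$ such that $\varphi(N,a_0)\subsetneq\varphi(N,a_1)\subsetneq\cdots$; NSOP is the negation of SOP. *)

(* Defs.v *)
From HB Require Import structures.
From mathcomp Require Import all_boot all_algebra.
From mathcomp Require Import classical_sets functions.

Set Implicit Arguments.
Unset Strict Implicit.
Unset Printing Implicit Defensive.

Import GRing.Theory.
Local Open Scope classical_set_scope.
Local Open Scope ring_scope.

HB.mixin Record Zmodule_isRng A of GRing.Zmodule A := {
  rngmul : A -> A -> A;
  rngmulA : associative rngmul;
  rngmulDl : left_distributive rngmul +%R;
  rngmulDr : right_distributive rngmul +%R
}.

#[short(type="rngType")]
HB.structure Definition Rng := { A of Zmodule_isRng A & GRing.Zmodule A }.

Section ApproximateSubrings.
Variable A : rngType.
Implicit Types (X Y Z D S : set A) (d : A) (n K N : nat).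

Definition setadd Y Z : set A := [set y + z | y in Y & z in Z].

Definition setmul Y Z : set A := [set rngmul y z | y in Y & z in Z].

Definition nsum n Z : set A :=
  [set s | exists2 z : 'I_n -> A, (forall i, Z (z i)) & s = \sum_(i < n) z i].

Definition add_symmetric X : Prop := X 0 /\ (forall x, X (- x) <-> X x).

(* The translating elements [t i] may repeat, so [N] is an upper bound on the
   number of translates; they are taken in the ambient ring. *)
Definition covered_by_translates N Y X : Prop :=
  exists t : 'I_N -> A, Y `<=` \bigcup_(i in [set: 'I_N]) [set t i + x | x in X].

Definition approximate_subring K X : Prop :=
  add_symmetric X /\ covered_by_translates K (setmul X X `|` setadd X X) X.

Definition commensurable N Y X : Prop :=
  covered_by_translates N Y X /\ covered_by_translates N X Y.

Fixpoint ring_layer X n : set A :=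
  if n is m.+1 then
    let Z := ring_layer X m in setadd (setadd Z Z) (setmul Z Z)
  else X.

(* For additively symmetric [X], this is the subring generated by [X]. *)
Definition ring_span X : set A := \bigcup_(n in [set: nat]) ring_layer X n.

Definition is_subring S : Prop :=
  [/\ S 0, forall x y, S x -> S y -> S (x - y)
    & forall x y, S x -> S y -> S (rngmul x y)].

Definition thick D Y : Prop :=
  [/\ D `<=` Y, add_symmetric D &
      exists2 N, (0 < N)%N &
        forall r : 'I_N -> A, (forall i, Y (r i)) ->
          exists i j : 'I_N, (i < j)%N /\ D (r i - r j)].

Definition zero_divisor S d : Prop :=
  S d /\ exists x, [/\ S x, x <> 0 & rngmul d x = 0 \/ rngmul x d = 0].

End ApproximateSubrings.

Record language : Type := Language {
  fun_symb : Type;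
  fun_arity : fun_symb -> nat;
  rel_symb : Type;
  rel_arity : rel_symb -> nat
}.

Record structure (L : language) : Type := Structure {
  dom :> Type;
  dom_inhabited : inhabited dom;
  fun_interp : forall f : fun_symb L, (fun_arity f).-tuple dom -> dom;
  rel_interp : forall r : rel_symb L, (rel_arity r).-tuple dom -> Prop
}.

Section Syntax.
Variable L : language.

(* Free variables are indexed by ['I_n]. *)
Inductive term (n : nat) : Type :=
| Var of 'I_n
| App (f : fun_symb L) of ('I_(fun_arity f) -> term n).

(* The quantifier binds variable [0] of its body; the other variables are
   shifted by one. The logic is classical, so the remaining connectives and
   the existential quantifier are definable from these. *)
Inductive formula : nat -> Type :=
| Bot n : formula n
| Equal n of term n & term n : formula n
| Rel n (r : rel_symb L) of ('I_(rel_arity r) -> term n) : formula n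
| Imp n of formula n & formula n : formula n
| All n of formula n.+1 : formula n.

Definition sentence := formula 0.

End Syntax.

Arguments App [L n] f _.
Arguments Rel [L n] r _.

Section Semantics.
Variables (L : language) (M : structure L).

Fixpoint eval n (e : n.-tuple M) (t : term L n) : M :=
  match t with
  | Var i => tnth e i
  | App f ts => fun_interp [tuple eval e (ts i) | i < fun_arity f]
  end.

Fixpoint sat n (phi : formula L n) : n.-tuple M -> Prop :=
  match phi in formula _ n return n.-tuple M -> Prop with
  | Bot _ => fun=> False
  | Equal _ t u => fun e => eval e t = eval e u
  | Rel _ r ts => fun e => rel_interp [tuple eval e (ts i) | i < rel_arity r]
  | Imp _ phi psi => fun e => sat phi e -> sat psi e
  | All _ phi => fun e => forall x : M, sat phi [tuple of x :: e]
  end.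

Definition solutions m p (phi : formula L (m + p)) (b : p.-tuple M) :
    set (m.-tuple M) :=
  [set a : m.-tuple M | sat phi [tuple of a ++ b]].

Definition definable m (S : set (m.-tuple M)) : Prop :=
  exists p (phi : formula L (m + p)) (b : p.-tuple M), S = solutions phi b.

Definition Th : set (sentence L) := [set phi | sat phi [tuple]].

End Semantics.

Definition is_model L (T : set (sentence L)) (N : structure L) : Prop :=
  forall phi, T phi -> sat phi ([tuple] : 0.-tuple N).

Definition SOP L (T : set (sentence L)) : Prop :=
  exists m p (phi : formula L (m + p)) (N : structure L),
    is_model T N /\
    exists a : nat -> p.-tuple N,
      forall i, solutions phi (a i) `<` solutions phi (a i.+1).

Definition NSOP L (T : set (sentence L)) : Prop := ~ SOP T.

(* The subset [X] is viewed inside a Cartesian power of [M] through a coding [c] of ring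
   elements by [k]-tuples, injective on the ring generated by [X]; the values
   of [c] outside that ring are irrelevant. *)
Section Definability.
Variables (L : language) (M : structure L) (A : rngType).
Variables (k : nat) (c : A -> k.-tuple M).

Definition definable_subset (D : set A) : Prop := definable (c @` D).

Definition definable_op_on (op : A -> A -> A) (Z : set A) : Prop :=
  definable
    [set [tuple of c u ++ [tuple of c v ++ c (op u v)]] | u in Z & v in Z].

Definition definable_in (X : set A) : Prop :=
  [/\ set_inj (ring_span X) c,
      forall n, definable_subset (ring_layer X n),
      forall n, definable_op_on +%R (ring_layer X n)
    & forall n, definable_op_on (@rngmul A) (ring_layer X n)].

End Definability.

(* Main.v *)
Require Import Defs.
From mathcomp Require Import all_boot all_algebra.
From mathcomp Require Import boolp classical_sets functions.

Local Open Scope classical_set_scope.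

(** Put [Z = X_n] with [n >= 4], so that [Y] is contained in [Z], and cover [Z] by
    [T + X] with [T] finite.  By the pigeonhole principle, among sufficiently many
    elements of [X] there are two, [r] and [s], such that [(r - s) T] is contained in
    [X - X] and the sets [r X] and [s X] meet the same translates [f + X], [f] in a
    fixed finite set.  Then [d = r - s] maps [Z] into [4X + r 4X], hence into [Y], and for
    a prescribed [v] one also gets [v d] in [X - X].  If zero divisors contain no
    definable thick subset of [Y], such a [d] can be chosen to be cancellable on [Z].
    Iterating, one finds [v_i = d_0 ... d_i], all in [X - X], with [v_i Z] decreasing; if
    [Z] were larger than [Y], the sequence of uniformly definable sets [v_i Z] would be
    strictly decreasing, contradicting NSOP.  Hence every [X_n] with [n >= 4] is contained
    in [Y]. *)

(** * Definable predicates *)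

Section FirstOrderDefinability.
Set Implicit Arguments.
Unset Strict Implicit.
Variables (L : language) (M : structure L).
Implicit Types (n m p : nat) (P Q : seq M -> Prop).

Fixpoint rename_term n m (s : 'I_n -> 'I_m) (t : term L n) : term L m :=
  match t with
  | Var i => Var L (s i)
  | App f ts => App f (fun i => rename_term s (ts i))
  end.

(** A quantifier binds variable [0], so index [0] is fixed and the others are renamed after the
    shift. *)
Definition lift_renaming n m (s : 'I_n -> 'I_m) (i : 'I_n.+1) : 'I_m.+1 :=
  oapp (fun j => lift ord0 (s j)) ord0 (unlift ord0 i).

Fixpoint rename n (phi : formula L n) : forall m, ('I_n -> 'I_m) -> formula L m :=
  match phi in formula _ n return forall m, ('I_n -> 'I_m) -> formula L m with
  | Bot _ => fun m _ => Bot L m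
  | Equal _ t u => fun m s => Equal (rename_term s t) (rename_term s u)
  | Rel _ r ts => fun m s => Rel r (fun i => rename_term s (ts i))
  | Imp _ phi psi => fun m s => Imp (rename phi s) (rename psi s)
  | All _ phi => fun m s => All (rename phi (lift_renaming s))
  end.

Lemma eval_rename n m (s : 'I_n -> 'I_m) (e : m.-tuple M) t :
  eval e (rename_term s t) = eval [tuple tnth e (s i) | i < n] t.
Proof.
elim: t => [i|f ts IH] /=; first by rewrite tnth_mktuple.
by congr (fun_interp _); apply: eq_mktuple => i.
Qed.

Lemma sat_rename n (phi : formula L n) m (s : 'I_n -> 'I_m) (e : m.-tuple M) :
  sat (rename phi s) e <-> sat phi [tuple tnth e (s i) | i < n].
Proof.
elim: phi m s e => {n} [n|n t u|n r ts|n phi IHphi psi IHpsi|n phi IH] m s e /=.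
- by [].
- by rewrite !eval_rename.
- suff -> : [tuple eval e (rename_term s (ts i)) | i < rel_arity r] =
    [tuple eval [tuple tnth e (s i0) | i0 < n] (ts i) | i < rel_arity r] by [].
  by apply: eq_mktuple => i; rewrite eval_rename.
- by rewrite IHphi IHpsi.
suff E x : [tuple tnth [tuple of x :: e] (lift_renaming s i) | i < n.+1] =
    [tuple of x :: [tuple tnth e (s i) | i < n]].
  by split=> H x; have := H x; rewrite IH E.
apply: eq_from_tnth => i; rewrite tnth_mktuple /lift_renaming.
case: (unliftP ord0 i) => [j|] -> /=; last by rewrite !tnth0.
by rewrite !tnthS tnth_mktuple.
Qed.

(* Predicates on sequences avoid casts between tuple types; only the sequences
   of length [n] matter. *)
Definition definable_pred n P := exists p (phi : formula L (n + p)) (b : p.-tuple M),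
  forall a : n.-tuple M, P a <-> sat phi [tuple of a ++ b].

Lemma definable_pred_ext n P Q :
  (forall a : n.-tuple M, P a <-> Q a) -> definable_pred n P -> definable_pred n Q.
Proof.
by move=> PQ [p [phi [b H]]]; exists p, phi, b => a; rewrite -PQ.
Qed.

Lemma definableP n (S : set (n.-tuple M)) P :
  (forall a : n.-tuple M, S a <-> P a) -> definable S <-> definable_pred n P.
Proof.
move=> SP; split=> -[p [phi [b H]]]; exists p, phi, b.
  by move=> a; rewrite -SP H.
by apply/predeqP => a; rewrite SP H.
Qed.

(** The entries of [a] serve as their own default values for [nth], so no element of [M] has to be
    chosen. *)
Lemma definable_pred_rename n m (s : 'I_n -> 'I_m) P :
  definable_pred n P ->
  definable_pred m (fun e => exists2 a : n.-tuple M,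
    P a & forall i, tnth a i = nth (tnth a i) e (s i)).
Proof.
move=> [p [phi [b H]]].
pose sg (i : 'I_(n + p)) : 'I_(m + p) :=
  match fintype.split i with inl j => lshift p (s j) | inr j => rshift m j end.
exists p, (rename phi sg), b => e; rewrite sat_rename.
have -> : [tuple tnth [tuple of e ++ b] (sg i) | i < n + p] =
    [tuple of [tuple tnth e (s i) | i < n] ++ b].
  apply: eq_from_tnth => i; rewrite tnth_mktuple /sg.
  by case: (split_ordP i) => j ->; rewrite ?tnth_lshift ?tnth_rshift ?tnth_mktuple.
rewrite -H; split=> [[a Pa Ha]|Pe].
  suff <- : a = [tuple tnth e (s i) | i < n] by [].
  by apply: eq_from_tnth => i; rewrite tnth_mktuple Ha [RHS](tnth_nth (tnth a i)).
exists [tuple tnth e (s i) | i < n] => // i.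
by rewrite -tnth_nth tnth_mktuple.
Qed.

Lemma definable_pred_map (x0 : M) n m (s : seq nat) P :
  size s = n -> all (fun i => i < m)%N s ->
  definable_pred n P -> definable_pred m (fun e => P [seq nth x0 e i | i <- s]).
Proof.
move=> sz_s /allP s_lt dP.
have lt (i : 'I_n) : (nth 0 s i < m)%N by apply/s_lt/mem_nth; rewrite sz_s.
apply: definable_pred_ext (definable_pred_rename (fun i => Ordinal (lt i)) dP) => e.
have E (a : n.-tuple M) : (forall i, tnth a i = nth (tnth a i) e (nth 0 s i)) ->
    [seq nth x0 e i | i <- s] = a.
  move=> H; apply: (@eq_from_nth _ x0); first by rewrite size_map size_tuple.
  move=> i; rewrite size_map sz_s => lt_i.
  rewrite (nth_map 0) ?sz_s // -[i]/(nat_of_ord (Ordinal lt_i)) -tnth_nth H.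
  by apply: set_nth_default; rewrite size_tuple lt.
split=> [[a Pa Ha]|Pe]; first by rewrite (E a).
have sz : size [seq nth x0 e i | i <- s] == n by rewrite size_map sz_s.
exists (Tuple sz) => // i; rewrite (tnth_nth x0) /= (nth_map 0) ?sz_s //.
by apply: set_nth_default; rewrite size_tuple lt.
Qed.

Lemma definable_pred_imp n P Q :
  definable_pred n P -> definable_pred n Q -> definable_pred n (fun e => P e -> Q e).
Proof.
move=> [p [phi [b Hb]]] [q [psi [d Hd]]].
(* The parameter tuples are concatenated; [s1] and [s2] direct each formula to its own part of
   [b ++ d]. *)
pose s1 (i : 'I_(n + p)) : 'I_(n + (p + q)) :=
  match fintype.split i with inl j => lshift _ j | inr j => rshift n (lshift q j) end.
pose s2 (i : 'I_(n + q)) : 'I_(n + (p + q)) :=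
  match fintype.split i with inl j => lshift _ j | inr j => rshift n (rshift p j) end.
exists (p + q)%N, (Imp (rename phi s1) (rename psi s2)), [tuple of b ++ d] => a /=.
rewrite !sat_rename.
have -> : [tuple tnth [tuple of a ++ [tuple of b ++ d]] (s1 i) | i < n + p] =
    [tuple of a ++ b].
  apply: eq_from_tnth => i; rewrite tnth_mktuple /s1.
  by case: (split_ordP i) => j ->; rewrite ?(tnth_lshift, tnth_rshift).
have -> : [tuple tnth [tuple of a ++ [tuple of b ++ d]] (s2 i) | i < n + q] =
    [tuple of a ++ d].
  apply: eq_from_tnth => i; rewrite tnth_mktuple /s2.
  by case: (split_ordP i) => j ->; rewrite ?(tnth_lshift, tnth_rshift).
by rewrite -Hb -Hd.
Qed.

Lemma definable_pred_not n P : definable_pred n P -> definable_pred n (fun e => ~ P e).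
Proof.
move=> dP; apply: definable_pred_imp => //.
by exists 0%N, (Bot L _), [tuple].
Qed.

Lemma definable_pred_and n P Q :
  definable_pred n P -> definable_pred n Q -> definable_pred n (fun e => P e /\ Q e).
Proof.
move=> dP dQ.
apply: definable_pred_ext (definable_pred_not (definable_pred_imp dP (definable_pred_not dQ))).
move=> a; split=> [|[Pa Qa] H]; last exact: H.
by move/not_implyP => [Pa /contrapT].
Qed.

Lemma definable_pred_all1 n P :
  definable_pred n.+1 P -> definable_pred n (fun e => forall x, P (x :: e)).
Proof.
move=> [p [phi [b H]]]; exists p, (All (phi : formula L (n + p).+1)), b => a /=.
by split=> S x; have := S x; rewrite -[x :: a]/(tval [tuple of x :: a]) H;
  congr (sat phi _); apply: val_inj.
Qed.

Lemma definable_pred_all k n P : definable_pred (k + n) P ->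
  definable_pred n (fun e => forall z : k.-tuple M, P (z ++ e)).
Proof.
elim: k P => [|k IH] P dP.
  by apply: definable_pred_ext dP => a; split=> [H z|/(_ [tuple])//]; rewrite (tuple0 z).
apply: definable_pred_ext (IH _ (definable_pred_all1 dP)) => a.
split=> H z; last by move=> x; exact: (H [tuple of x :: z]).
by rewrite (tuple_eta z) /=; exact: (H [tuple of behead z] (thead z)).
Qed.

Lemma definable_pred_ex k n P : definable_pred (k + n) P ->
  definable_pred n (fun e => exists z : k.-tuple M, P (z ++ e)).
Proof.
move=> dP.
apply: definable_pred_ext
  (definable_pred_not (definable_pred_all (definable_pred_not dP))) => a.
split=> [|[z Pz] H]; last exact: (H z).
by move/existsNP => [z /contrapT]; exists z.
Qed.

(** [SOP] asks for an increasing chain, hence the passage to complements of the fibers of [P]. The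
    model is [M] itself, and [v i] joins [b] among the parameters. *)
Lemma SOP_of_decreasing_fibers k (P : seq M -> Prop) (v : nat -> k.-tuple M) :
  definable_pred (k + k) P ->
  (forall i (x : k.-tuple M), P (x ++ v i.+1) -> P (x ++ v i)) ->
  (forall i, exists2 x : k.-tuple M, P (x ++ v i) & ~ P (x ++ v i.+1)) ->
  SOP (Th M).
Proof.
move=> /definable_pred_not [p [phi [b H]]] decr strict.
pose phi' := rename phi (cast_ord (esym (addnA k k p))).
have Hphi' i x : solutions phi' [tuple of v i ++ b] x <-> ~ P (x ++ v i).
  rewrite -[x ++ v i]/(tval [tuple of x ++ v i]) H /solutions /= sat_rename.
  suff -> : [tuple tnth [tuple of x ++ [tuple of v i ++ b]]
      (cast_ord (esym (addnA k k p)) j) | j < k + k + p] =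
      [tuple of [tuple of x ++ v i] ++ b] by [].
  apply: eq_from_tnth => j; rewrite tnth_mktuple.
  have x0 := tnth [tuple of [tuple of x ++ v i] ++ b] j.
  by rewrite !(tnth_nth x0) /= catA.
exists k, (k + p)%N, phi', M; split=> //.
exists (fun i => [tuple of v i ++ b]) => i; split.
  by move=> x /Hphi' nP; apply/Hphi' => /decr.
move=> sub; have [x Px nPx] := strict i.
by have /Hphi' := sub x ((Hphi' i.+1 x).2 nPx).
Qed.

End FirstOrderDefinability.

(** * Coverings and colorings *)

Section RngTheory.
Set Implicit Arguments.
Unset Strict Implicit.
Import GRing.Theory.
Local Open Scope ring_scope.
Variable A : rngType.
Implicit Types x y z : A.
Local Notation "x ** y" := (rngmul x y) (at level 40, left associativity).

Lemma rngmul0r x : 0 ** x = 0.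
Proof. by apply: (addIr (0 ** x)); rewrite -rngmulDl !add0r. Qed.

Lemma rngmulr0 x : x ** 0 = 0.
Proof. by apply: (addIr (x ** 0)); rewrite -rngmulDr !add0r. Qed.

Lemma rngmulNr x y : - x ** y = - (x ** y).
Proof. by apply: (addIr (x ** y)); rewrite -rngmulDl !addNr rngmul0r. Qed.

Lemma rngmulrN x y : x ** - y = - (x ** y).
Proof. by apply: (addIr (x ** y)); rewrite -rngmulDr !addNr rngmulr0. Qed.

Lemma rngmulBl x y z : (x - y) ** z = x ** z - y ** z.
Proof. by rewrite rngmulDl rngmulNr. Qed.

Lemma rngmulBr x y z : x ** (y - z) = x ** y - x ** z.
Proof. by rewrite rngmulDr rngmulrN. Qed.

Lemma nsum4P (X : set A) s :
  nsum 4 X s <-> exists a b c d, [/\ X a, X b, X c, X d & s = a + b + (c + d)].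
Proof.
split=> [[z Xz ->]|[a [b [c [d [Xa Xb Xc Xd ->]]]]]].
  exists (z ord0), (z (lift ord0 ord0)), (z (lift ord0 (lift ord0 ord0))),
    (z (lift ord0 (lift ord0 (lift ord0 ord0)))).
  by split=> //; rewrite !big_ord_recl big_ord0 addr0 !addrA.
exists (fun i : 'I_4 => nth 0 [:: a; b; c; d] i).
  by case=> [[|[|[|[|i]]]] lt_i].
by rewrite !big_ord_recl big_ord0 addr0 /= !addrA.
Qed.

(** Only finiteness counts in the descent argument; the explicit bound for commensurability is
    tracked by [covered_by_translates]. *)
Definition finitely_covered (B S : set A) : Prop :=
  exists T : seq A, forall y, S y -> exists2 t, t \in T & B (y - t).

Lemma finitely_covered_sub B S S' :
  S `<=` S' -> finitely_covered B S' -> finitely_covered B S.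
Proof. by move=> sub [T H]; exists T => y /sub /H. Qed.

Lemma finitely_covered_trans B B' S :
  finitely_covered B B' -> finitely_covered B' S -> finitely_covered B S.
Proof.
move=> [T HT] [T' HT']; exists [seq t + t' | t <- T, t' <- T'] => y /HT' [t' t'T'].
move=> /HT [t tT Bt]; exists (t + t'); first exact: allpairs_f.
by rewrite opprD addrA addrAC.
Qed.

Lemma finitely_covered_add B B' S S' :
  finitely_covered B S -> finitely_covered B' S' ->
  finitely_covered (setadd B B') (setadd S S').
Proof.
move=> [T HT] [T' HT']; exists [seq t + t' | t <- T, t' <- T'].
move=> _ [x Sx [y Sy <-]]; have [t tT Bt] := HT x Sx; have [t' tT' Bt'] := HT' y Sy.
exists (t + t'); first exact: allpairs_f.
by rewrite opprD addrACA; exists (x - t) => //; exists (y - t').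
Qed.

Lemma finitely_covered_seq B (T : seq A) : B 0 -> finitely_covered B [set t | t \in T].
Proof. by move=> B0; exists T => t tT; exists t; rewrite ?subrr. Qed.

Lemma finitely_covered_bigcup B (T : seq A) (F : A -> set A) :
  (forall t, t \in T -> finitely_covered B (F t)) ->
  finitely_covered B [set y | exists2 t, t \in T & F t y].
Proof.
elim: T => [|t T IH] H; first by exists [::] => y [t].
have [T1 H1] := H t (mem_head _ _).
have [|T2 H2] := IH; first by move=> s sT; apply: H; rewrite inE sT orbT.
exists (T1 ++ T2) => y [s]; rewrite inE => /predU1P[->|sT] Fy.
  by have [u uT Bu] := H1 y Fy; exists u; rewrite // mem_cat uT.
have [|u uT Bu] := H2 y; first by exists s.
by exists u; rewrite // mem_cat uT orbT.
Qed.

Lemma finitely_covered_of_translates N (B S : set A) :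
  covered_by_translates N S B -> finitely_covered B S.
Proof.
move=> [t sub]; exists [seq t i | i <- enum 'I_N] => y /sub [i _ [x Bx <-]].
by exists (t i); [rewrite map_f ?mem_enum|rewrite addrC addKr].
Qed.

Lemma covered_by_translates_fin (C : finType) (t : C -> A) (B S : set A) :
  (forall y, S y -> exists i, B (y - t i)) -> covered_by_translates #|C| S B.
Proof.
move=> H; exists (t \o enum_val) => y /H [i Bi]; exists (enum_rank i) => //.
by exists (y - t i); rewrite //= enum_rankK addrC subrK.
Qed.

Lemma covered_by_translates_sub N (B S S' : set A) :
  S `<=` S' -> covered_by_translates N S' B -> covered_by_translates N S B.
Proof. by move=> sub [t H]; exists t; exact: subset_trans H. Qed.

(** [S + S'] lies in the [N * N'] translates of [B + B] by the sums [t i + t' j], each of which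
    needs [K] translates of [B]. *)
Lemma covered_by_translates_add N N' K (B S S' : set A) :
  covered_by_translates K (setadd B B) B ->
  covered_by_translates N S B -> covered_by_translates N' S' B ->
  covered_by_translates (N * N' * K) (setadd S S') B.
Proof.
move=> [f Hf] [t Ht] [t' Ht'].
rewrite -{1}(card_ord N) -{1}(card_ord N') -{1}(card_ord K) -!card_prod.
apply: (@covered_by_translates_fin _ (fun i => t i.1.1 + t' i.1.2 + f i.2)).
move=> _ [x /Ht [i _ [b Bb <-]] [y /Ht' [j _ [b' Bb' <-]] <-]].
have [|l _ [x' Bx' E]] := Hf (b + b'); first by exists b => //; exists b'.
exists (i, j, l) => /=.
by rewrite addrACA -E addrA [_ + x']addrC addrK.
Qed.

(** [E] need only contain an equivalence relation of finite index on [S]; it may itself fail to be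
    symmetric or transitive. *)
Definition finitely_colorable (S : set A) (E : A -> A -> Prop) : Prop :=
  exists (C : finType) (chi : A -> C),
    forall x y, S x -> S y -> chi x = chi y -> E x y.

Lemma finitely_colorable_and S (E E' : A -> A -> Prop) :
  finitely_colorable S E -> finitely_colorable S E' ->
  finitely_colorable S (fun x y => E x y /\ E' x y).
Proof.
move=> [C [chi H]] [C' [chi' H']]; exists (C * C')%type, (fun x => (chi x, chi' x)).
by move=> x y Sx Sy [e e']; split; [exact: H|exact: H'].
Qed.

Lemma finitely_colorable_all S (T : seq A) (E : A -> A -> A -> Prop) :
  (forall t, t \in T -> finitely_colorable S (E t)) ->
  finitely_colorable S (fun x y => forall t, t \in T -> E t x y).
Proof.
elim: T => [|t T IH] H; first by exists unit, (fun=> tt).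
have [|C [chi Hc]] := finitely_colorable_and (H t (mem_head _ _)) (IH _).
  by move=> s sT; apply: H; rewrite inE sT orbT.
exists C, chi => x y Sx Sy e; have [Et ET] := Hc x y Sx Sy e.
by move=> s; rewrite inE => /predU1P[->|/ET].
Qed.

Lemma finitely_colorable_pred S (P : set A) :
  finitely_colorable S (fun x y => P x -> P y).
Proof.
exists bool, (fun x => `[< P x >]) => x y _ _ e /asboolP.
by rewrite e => /asboolP.
Qed.

Lemma finitely_colorable_cover S (g : A -> A) B :
  finitely_covered B [set g x | x in S] ->
  finitely_colorable S (fun x y => exists2 t, B (g x - t) & B (g y - t)).
Proof.
move=> [T HT]; pose p x := fun t => `[< B (g x - t) >].
(* The color is the position of the first translate that contains [g x]. [find] can return [size T],
   whence the successor. *)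
exists 'I_(size T).+1, (fun x => inord (find (p x) T)) => x y Sx Sy /(congr1 val) /=.
rewrite !inordK ?ltnS ?find_size // => e.
have has_p z : S z -> has (p z) T.
  move=> Sz; have [|t tT Bt] := HT (g z); first by exists z.
  by apply/hasP; exists t => //; apply/asboolP.
have /asboolP Bx := nth_find 0 (has_p x Sx); have /asboolP By := nth_find 0 (has_p y Sy).
by exists (nth 0 T (find (p x) T)); rewrite // e.
Qed.

Lemma finitely_colorable_pigeonhole S (E : A -> A -> Prop) :
  finitely_colorable S E ->
  exists2 N, (0 < N)%N & forall r : 'I_N -> A, (forall i, S (r i)) ->
    exists i j : 'I_N, (i < j)%N /\ E (r i) (r j).
Proof.
move=> [C [chi H]]; exists #|C|.+1 => // r Sr.
have /injectivePn[i [j]] : ~~ injectiveb (chi \o r).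
  by apply/negP => /injectiveP /leq_card; rewrite card_ord ltnn.
(* Sharing a color is symmetric, so the two indices can be taken in increasing order. *)
rewrite neq_ltn => /orP[lt_ij|lt_ji] /= e; first by exists i, j; split=> //; exact: H.
by exists j, i; split=> //; apply: H.
Qed.

End RngTheory.

(** * Layers of an approximate subring *)

Section Layers.
Set Implicit Arguments.
Unset Strict Implicit.
Import GRing.Theory.
Local Open Scope ring_scope.
Variables (A : rngType) (X : set A).
Hypothesis symX : add_symmetric X.
Local Notation "x ** y" := (rngmul x y) (at level 40, left associativity).
Local Notation Y := (setadd (nsum 4 X) (setmul X (nsum 4 X))).

(** The sum and product rules for layers follow from this one by replacing some of the entries by
    [0]. *)
Lemma layer_sum n (a b c d : A) :
  ring_layer X n a -> ring_layer X n b -> ring_layer X n c -> ring_layer X n d ->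
  ring_layer X n.+1 (a + b + c ** d).
Proof.
by move=> Xa Xb Xc Xd; exists (a + b); [exists a => //; exists b|exists (c ** d) => //; exists c => //; exists d].
Qed.

Lemma layer0 n : ring_layer X n 0.
Proof.
elim: n => [|n IH]; first by case: symX.
by have := layer_sum IH IH IH IH; rewrite rngmul0r !addr0.
Qed.

Lemma layerD n x y : ring_layer X n x -> ring_layer X n y -> ring_layer X n.+1 (x + y).
Proof.
by move=> Xx Xy; have := layer_sum Xx Xy (layer0 n) (layer0 n); rewrite rngmul0r addr0.
Qed.

Lemma layerM n x y : ring_layer X n x -> ring_layer X n y -> ring_layer X n.+1 (x ** y).
Proof.
by move=> Xx Xy; have := layer_sum (layer0 n) (layer0 n) Xx Xy; rewrite !add0r.
Qed.

Lemma layerN n x : ring_layer X n x -> ring_layer X n (- x).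
Proof.
elim: n x => [|n IH] x; first by move=> Xx; apply/symX.2.
move=> [_ [a Xa [b Xb <-]] [_ [c Xc [d Xd <-]] <-]].
by rewrite !opprD -rngmulNr; apply: layer_sum; try exact: IH.
Qed.

Lemma layerB n x y : ring_layer X n x -> ring_layer X n y -> ring_layer X n.+1 (x - y).
Proof. by move=> Xx /layerN; apply: layerD. Qed.

Lemma layer_le m n : (m <= n)%N -> ring_layer X m `<=` ring_layer X n.
Proof.
move=> /subnK <-; elim: (n - m)%N => // k IH x /IH Xx.
by have := layerD Xx (layer0 _); rewrite addr0.
Qed.

Lemma span_layer n : ring_layer X n `<=` ring_span X.
Proof. by move=> x Xx; exists n. Qed.

Lemma span_layer2 x y : ring_span X x -> ring_span X y ->
  exists n, ring_layer X n x /\ ring_layer X n y.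
Proof.
move=> [m _ Xx] [n _ Xy]; exists (maxn m n).
by split; [apply: layer_le Xx; rewrite leq_maxl|apply: layer_le Xy; rewrite leq_maxr].
Qed.

Lemma spanB x y : ring_span X x -> ring_span X y -> ring_span X (x - y).
Proof. by move=> /span_layer2 H /H [n [Xx Xy]]; exists n.+1 => //; exact: layerB. Qed.

Lemma nsum4_layer2 : nsum 4 X `<=` ring_layer X 2.
Proof.
move=> _ /nsum4P [a [b [c [d [Xa Xb Xc Xd ->]]]]].
by apply: layerD; apply: (@layerD 0).
Qed.

(** Sums of four elements of [X] lie in [X_2], their products with [X] in [X_3], and the final sum
    in [X_4]. *)
Lemma target_layer4 : Y `<=` ring_layer X 4.
Proof.
move=> _ [s /nsum4_layer2 Xs [_ [x Xx [s' /nsum4_layer2 Xs' <-]] <-]].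
apply: layerD; first exact: (layer_le (leqnSn 2)).
by apply: layerM => //; apply: (@layer_le 0 2).
Qed.

(** Zeros fill the missing summands. Through this inclusion the zero divisors, chosen in [X_1], form
    a subset of [Y]. *)
Lemma layer1_target : ring_layer X 1 `<=` Y.
Proof.
have X0 := symX.1.
move=> _ [_ [a Xa [b Xb <-]] [_ [c Xc [d Xd <-]] <-]].
exists (a + b); first by apply/nsum4P; exists a, b, 0, 0; rewrite !addr0.
exists (c ** d) => //; exists c => //; exists d => //.
by apply/nsum4P; exists d, 0, 0, 0; rewrite !addr0.
Qed.

Lemma sub_target : X `<=` Y.
Proof. by move=> x Xx; apply/layer1_target/(@layer_le 0 1). Qed.

Section FiniteCovers.
Hypothesis covX : finitely_covered X (setmul X X `|` setadd X X).

Lemma finitely_covered_setadd S S' :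
  finitely_covered X S -> finitely_covered X S' -> finitely_covered X (setadd S S').
Proof.
move=> cS cS'; apply: finitely_covered_trans (finitely_covered_add cS cS').
by apply: finitely_covered_sub covX; exact: subsetUr.
Qed.

(** Induction on the layer of [t]: for [t = a + b + c ** d], the set [t X] lies in
    [a X + b X + c (d X)], and a cover of [d X] by [T + X] puts [c (d X)] in [c T + c X]. *)
Lemma finitely_covered_lmul t : ring_span X t -> finitely_covered X [set t ** x | x in X].
Proof.
case=> n _; elim: n t => [|n IH] t.
  by move=> Xt; apply: finitely_covered_sub covX => _ [x Xx <-]; left; exists t => //; exists x.
move=> [_ [a Xa [b Xb <-]] [_ [c Xc [d Xd <-]] <-]].
apply: (@finitely_covered_sub _ _ _ (setadd (setadd [set a ** x | x in X] [set b ** x | x in X])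
    [set c ** y | y in [set d ** x | x in X]])).
  move=> _ [x Xx <-]; rewrite !rngmulDl -rngmulA.
  exists (a ** x + b ** x); last by exists (c ** (d ** x)) => //; exists (d ** x) => //; exists x.
  by exists (a ** x); [exists x|exists (b ** x) => //; exists x].
apply: finitely_covered_setadd; first by apply: finitely_covered_setadd; exact: IH.
apply: finitely_covered_trans (IH c Xc) _; have [T HT] := IH d Xd.
exists [seq c ** t | t <- T] => _ [y /HT [s sT Xs] <-].
exists (c ** s); first exact: map_f.
by rewrite -rngmulBr; exists (y - s).
Qed.

Lemma finitely_covered_rmul t : ring_span X t -> finitely_covered X [set x ** t | x in X].
Proof.
case=> n _; elim: n t => [|n IH] t.
  by move=> Xt; apply: finitely_covered_sub covX => _ [x Xx <-]; left; exists x => //; exists t.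
move=> [_ [a Xa [b Xb <-]] [_ [c Xc [d Xd <-]] <-]].
apply: (@finitely_covered_sub _ _ _ (setadd (setadd [set x ** a | x in X] [set x ** b | x in X])
    [set y ** d | y in [set x ** c | x in X]])).
  move=> _ [x Xx <-]; rewrite !rngmulDr rngmulA.
  exists (x ** a + x ** b); last by exists (x ** c ** d) => //; exists (x ** c) => //; exists x.
  by exists (x ** a); [exists x|exists (x ** b) => //; exists x].
apply: finitely_covered_setadd; first by apply: finitely_covered_setadd; exact: IH.
apply: finitely_covered_trans (IH d Xd) _; have [T HT] := IH c Xc.
exists [seq t ** d | t <- T] => _ [y /HT [s sT Xs] <-].
exists (s ** d); first exact: (map_f (fun t => t ** d)).
by rewrite -rngmulBl; exists (y - s).
Qed.

(* Translating elements that are used at all lie in the span. *)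
Lemma finitely_covered_span S : S `<=` ring_span X -> finitely_covered X S ->
  exists T : seq A, (forall t, t \in T -> ring_span X t) /\
    forall y, S y -> exists2 t, t \in T & X (y - t).
Proof.
move=> sub [T HT]; exists [seq t <- T | `[< ring_span X t >]]; split=> [t|y Sy].
  by rewrite mem_filter => /andP[/asboolP].
have [t tT Xt] := HT y Sy; exists t => //; rewrite mem_filter tT andbT.
by apply/asboolP; rewrite -(subKr y t); apply: spanB; [exact: sub|exact: (span_layer (n := 0))].
Qed.

(** Write the factors as [t + x] and [t' + x'] and expand. There are finitely many [t ** t']; the
    sets [t X] and [X t'] are covered because [t] and [t'] can be taken in the span. *)
Lemma finitely_covered_setmul S S' :
  S `<=` ring_span X -> S' `<=` ring_span X ->
  finitely_covered X S -> finitely_covered X S' -> finitely_covered X (setmul S S').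
Proof.
move=> subS subS' /(finitely_covered_span subS) [T [spT HT]].
move=> /(finitely_covered_span subS') [T' [spT' HT']].
apply: (@finitely_covered_sub _ _ _ (setadd
   (setadd [set u | u \in [seq t ** t' | t <- T, t' <- T']]
           [set y | exists2 t, t \in T & [set t ** x | x in X] y])
   (setadd [set y | exists2 t, t \in T' & [set x ** t | x in X] y] (setmul X X)))).
  move=> _ [y /HT [t tT Xt] [y' /HT' [t' tT' Xt'] <-]].
  exists (t ** t' + t ** (y' - t')).
    exists (t ** t'); first exact: allpairs_f.
    by exists (t ** (y' - t')) => //; exists t => //; exists (y' - t').
  exists ((y - t) ** t' + (y - t) ** (y' - t')).
    exists ((y - t) ** t'); first by exists t' => //; exists (y - t).
    by exists ((y - t) ** (y' - t')) => //; exists (y - t) => //; exists (y' - t').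
  by rewrite -!rngmulDr -rngmulDl !(addrC _ (_ - _)) !subrK.
apply: finitely_covered_setadd; apply: finitely_covered_setadd.
- exact/finitely_covered_seq/symX.1.
- by apply: finitely_covered_bigcup => t /spT /finitely_covered_lmul.
- by apply: finitely_covered_bigcup => t /spT' /finitely_covered_rmul.
- by apply: finitely_covered_sub covX; exact: subsetUl.
Qed.

Lemma finitely_covered_layer n : finitely_covered X (ring_layer X n).
Proof.
elim: n => [|n IH] /=.
  by exists [:: 0] => x Xx; exists 0; rewrite ?mem_head ?subr0.
apply: finitely_covered_setadd; first exact: finitely_covered_setadd.
by apply: finitely_covered_setmul => //; apply: span_layer.
Qed.

Lemma finitely_covered_layer_sub n S : S `<=` ring_layer X n -> finitely_covered X S.
Proof. by move=> sub; apply: finitely_covered_sub sub (finitely_covered_layer n). Qed.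

(** Requiring [v ** d] in [X_1] keeps products of arbitrarily many multipliers in one layer, where a
    single formula describes multiplication. *)
Definition multiplier n (v d : A) : Prop :=
  [/\ ring_layer X 1 d, ring_layer X 1 (v ** d)
    & forall z, ring_layer X n z -> Y (d ** z)].

(* Color [r] in [X] by the classes modulo [X] of [v r] and of [r t], for [t] in a
   finite set [T] with [X_n] covered by [T + X], and by the set of those
   translates [f + X] that [r X] meets.  If [r] and [s] get the same color, then
   [(r - s) t] is in [X - X] for [t] in [T], and for [x] in [X] there is [x'] in [X]
   with [s x] in [r x' + X - X], hence [(r - s) x] is in [r (X - X) + X - X]. *)
Lemma multiplier_colorable n v : ring_span X v ->
  finitely_colorable X (fun r s => multiplier n v (r - s)).
Proof.
move=> spv.
have [T [spT HT]] := finitely_covered_span (@span_layer n) (finitely_covered_layer n).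
have [F HF] := covX.
pose meets f r := exists2 x, X x & X (r ** x - f).
have colT t : t \in T ->
    finitely_colorable X (fun r s => exists2 u, X (r ** t - u) & X (s ** t - u)).
  by move=> /spT spt; apply: finitely_colorable_cover; exact: finitely_covered_rmul.
have colv := finitely_colorable_cover (finitely_covered_lmul spv).
have colF f : f \in F -> finitely_colorable X (fun r s => meets f s -> meets f r).
  move=> _; have [C [chi H]] := @finitely_colorable_pred _ X (meets f).
  by exists C, chi => r s Xr Xs e; apply: H.
have [C [chi H]] := finitely_colorable_and colv
  (finitely_colorable_and (finitely_colorable_all colT) (finitely_colorable_all colF)).
exists C, chi => r s Xr Xs /(H r s Xr Xs) [[u Xru Xsu] [ET EF]].
have subXX x y w : (x - w) - (y - w) = x - y :> A by rewrite opprB subrKA.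
split.
- exact: (@layerB 0).
- by rewrite rngmulBr -(subXX _ _ u); apply: (@layerB 0).
move=> z /HT [t tT Xx]; set x := z - t in Xx.
have -> : z = t + x by rewrite addrC subrK.
have [w Xrw Xsw] := ET t tT.
have [|f fF Xsf] := HF (s ** x); first by left; exists s => //; exists x.
have [|x' Xx' Xrf] := EF f fF; first by exists x.
have XN a : X a -> X (- a) by move=> Xa; apply/symX.2.
exists ((r ** t - w) - (s ** t - w) + ((r ** x' - f) - (s ** x - f))).
  apply/nsum4P; exists (r ** t - w), (- (s ** t - w)), (r ** x' - f), (- (s ** x - f)).
  by split=> //; apply: XN.
exists (r ** (x - x')).
  exists r => //; exists (x - x') => //; apply/nsum4P; exists x, (- x'), 0, 0.
  by split; rewrite ?addr0 //; [apply: XN|exact: symX.1|exact: symX.1].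
rewrite !subXX rngmulBr [RHS]rngmulDr !rngmulBl -addrA; congr (_ + _).
by rewrite addrC subrKA.
Qed.

(** Cover [Y] by [T + X] and color [y] by the translates [t + X] containing it and by the colors of
    all [y - t]. Two elements of the same color share some [t + X], and subtracting [t] from both
    preserves their difference. *)
Lemma multipliers_thick n v : ring_span X v ->
  exists2 N, (0 < N)%N & forall r : 'I_N -> A, (forall i, Y (r i)) ->
    exists i j : 'I_N, (i < j)%N /\ multiplier n v (r i - r j).
Proof.
move=> spv; have [T HT] := finitely_covered_layer_sub target_layer4.
pose S t := [set y | X (y - t)].
apply: (@finitely_colorable_pigeonhole _ Y (fun x y => multiplier n v (x - y))).
have col t : t \in T -> finitely_colorable Y
    (fun x y => S t x -> S t y -> multiplier n v (x - y)).
  move=> _; have [C [chi H]] := multiplier_colorable n spv.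
  exists C, (fun x => chi (x - t)) => x y _ _ e Xx Xy.
  by have := H _ _ Xx Xy e; rewrite opprB subrKA.
have colS t : t \in T -> finitely_colorable Y (fun x y => S t x -> S t y).
  by move=> _; exact: finitely_colorable_pred.
have [C [chi H]] := finitely_colorable_and (finitely_colorable_all col)
  (finitely_colorable_all colS).
exists C, chi => x y Yx Yy /(H x y Yx Yy) [E1 E2].
by have [t tT St] := HT x Yx; apply: (E1 t) => //; apply: E2.
Qed.

End FiniteCovers.

End Layers.

(** * Commensurability with an explicit constant *)

Section Commensurability.
Set Implicit Arguments.
Unset Strict Implicit.
Import GRing.Theory.
Local Open Scope ring_scope.

(** [Y] lies in [4X + 4(X X)]. As [X + X] and [X X] need [K] translates each, [4X] needs [K ^ 3],
    [4(X X)] needs [K ^ 7], and their sum [K ^ (3 + 7 + 1)]. *)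
Lemma target_commensurable (A : rngType) (X : set A) K :
  approximate_subring K X ->
  commensurable (K ^ 11)%N (setadd (nsum 4 X) (setmul X (nsum 4 X))) X.
Proof.
move=> [symX cov]; split; last first.
  have : (0 < K ^ 11)%N.
    (* [K] is positive because [0 + 0] has to be covered; so the single translate by [0] may be
       repeated [K ^ 11] times. *)
    have X0 := symX.1; rewrite expn_gt0 orbF; case: K cov => // -[t /(_ 0)[|[]]//].
    by right; exists 0 => //; exists 0; rewrite ?addr0.
  case: (K ^ 11)%N => // N _; exists (fun=> 0) => x Xx; exists ord0 => //.
  by exists x; rewrite ?add0r //; exact: sub_target.
have cD : covered_by_translates K (setadd X X) X.
  by apply: covered_by_translates_sub cov; exact: subsetUr.
have cM : covered_by_translates K (setmul X X) X.
  by apply: covered_by_translates_sub cov; exact: subsetUl.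
have add := covered_by_translates_add cD.
have c4 := add _ _ _ _ cD cD; have cM4 := add _ _ _ _ (add _ _ _ _ cM cM) (add _ _ _ _ cM cM).
have cY := add _ _ _ _ c4 cM4.
have <- : (K * K * K * (K * K * K * (K * K * K) * K) * K = K ^ 11)%N.
  by rewrite !expnS expn0 muln1 !mulnA.
apply: covered_by_translates_sub cY => y [s /nsum4P [a [b [c [d [Xa Xb Xc Xd ->]]]]]].
move=> [_ [x Xx [s' /nsum4P [a' [b' [c' [d' [Xa' Xb' Xc' Xd' ->]]]]] <-]] <-].
exists (a + b + (c + d)).
  by exists (a + b); [exists a => //; exists b|exists (c + d) => //; exists c => //; exists d].
eexists; last by [].
rewrite !rngmulDr; exists (rngmul x a' + rngmul x b').
  exists (rngmul x a'); first by exists x => //; exists a'.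
  by exists (rngmul x b') => //; exists x => //; exists b'.
exists (rngmul x c' + rngmul x d') => //.
exists (rngmul x c'); first by exists x => //; exists c'.
by exists (rngmul x d') => //; exists x => //; exists d'.
Qed.

End Commensurability.

(** * Regular multipliers and descending multiples *)

Section RegularMultipliers.
Set Implicit Arguments.
Unset Strict Implicit.
Import GRing.Theory.
Local Open Scope ring_scope.
Variables (A : rngType) (X : set A) (n : nat).
Hypothesis symX : add_symmetric X.
Hypothesis covX : finitely_covered X (setmul X X `|` setadd X X).
Local Notation "x ** y" := (rngmul x y) (at level 40, left associativity).
Local Notation Y := (setadd (nsum 4 X) (setmul X (nsum 4 X))).

(** The annihilated element ranges over the layer [n.+1] because differences of elements of [X_n]
    lie there: an element of [X_1] outside this set is left cancellable on [X_n]. Bounding the layer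
    makes the set definable. *)
Definition layer_zero_divisors : set A :=
  [set d | ring_layer X 1 d /\ exists x, [/\ ring_layer X n.+1 x, x <> 0 & d ** x = 0]].

Hypothesis n_ge4 : (4 <= n)%N.
Variable u : A.
Hypotheses (Xu : ring_layer X n u) (nYu : ~ Y u).

Let u_neq0 : u <> 0.
Proof. by move=> u0; apply: nYu; rewrite u0; exact/sub_target/symX.1. Qed.

Let Y_sub : Y `<=` ring_layer X n.
Proof. by move=> y /(target_layer4 symX) /(layer_le symX n_ge4). Qed.

Let X1_sub : ring_layer X 1 `<=` ring_layer X n.
Proof. by apply: (layer_le symX); apply: leq_trans n_ge4. Qed.

Hypothesis not_thick : ~ thick layer_zero_divisors Y.

(** Otherwise every multiplier for [v] is in [layer_zero_divisors], which inherits thickness from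
    [multipliers_thick]. *)
Lemma exists_regular_multiplier v : ring_span X v ->
  exists2 d, multiplier X n v d & ~ layer_zero_divisors d.
Proof.
move=> spv; apply: contrapT => no_d; apply: not_thick; split.
- by move=> d [/(layer1_target symX)].
- split.
    split; first exact: layer0.
    (* Additive symmetry includes [0], for which the nonzero element [u] is a witness. *)
    by exists u; split=> //; [exact: (layer_le symX (leqnSn n))|exact: rngmul0r].
  have N d : layer_zero_divisors d -> layer_zero_divisors (- d).
    move=> [X1d [x [Xx x0 dx0]]]; split; first exact: layerN.
    by exists x; rewrite rngmulNr dx0 oppr0.
  by move=> d; split=> [/N|]; [rewrite opprK|exact: N].
have [N N0 HN] := multipliers_thick symX covX n spv.
exists N => // r /HN [i [j [lt_ij mult]]]; exists i, j; split=> //.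
by apply: contrapT => nD; apply: no_d; exists (r i - r j).
Qed.

(* [v_i] is a product [d_0 ... d_i] of regular multipliers, each mapping [X_n] into
   the proper subset [Y] of [X_n]. *)
Lemma decreasing_multiples : exists v : nat -> A, forall i,
  [/\ ring_layer X n (v i),
      forall z, ring_layer X n z ->
        exists2 z', ring_layer X n z' & v i.+1 ** z = v i ** z'
    & exists2 z, ring_layer X n z &
        forall z', ring_layer X n z' -> v i ** z <> v i.+1 ** z'].
Proof.
pose good v := ring_layer X 1 v /\
  forall z z', ring_layer X n z -> ring_layer X n z' -> v ** z = v ** z' -> z = z'.
have regular d : ring_layer X 1 d -> ~ layer_zero_divisors d ->
    forall z z', ring_layer X n z -> ring_layer X n z' -> d ** z = d ** z' -> z = z'.
  move=> X1d nDd z z' Xz Xz' e; apply: contrapT => ne; apply: nDd; split=> //.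
  exists (z - z'); split; first exact: layerB.
    by move/subr0_eq.
  by rewrite rngmulBr e subrr.
(* The premise [good v] stands inside the existential so that [choice] yields a total function. *)
have step v : exists v', good v -> good v' /\ exists2 d,
    v' = v ** d & forall z, ring_layer X n z -> Y (d ** z).
  have [gv|ngv] := pselect (good v); last by exists v.
  have [d [X1d X1vd dY] nDd] := exists_regular_multiplier (span_layer gv.1).
  exists (v ** d) => _; split; last by exists d.
  split=> // z z' Xz Xz'; rewrite -!rngmulA => /gv.2 e.
  by apply: (regular d) => //; apply: e; exact/Y_sub/dY.
have [f Hf] := choice step.
have [v0 gv0] : exists v0, good v0.
  (* For [v = 0] the condition on [v ** d] is trivial. *)
  have [d [X1d _ _] nDd] := exists_regular_multiplier (span_layer (layer0 symX 1)).
  by exists d; split=> //; exact: regular.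
pose v i := iter i f v0.
have gv i : good (v i) by elim: i => //= i /Hf [].
exists v => i; have [_ [d Ed dY]] := Hf _ (gv i).
rewrite -[v i.+1]/(f (v i)) Ed; split.
- exact/X1_sub/(gv i).1.
- by move=> z Xz; exists (d ** z); rewrite ?rngmulA //; exact/Y_sub/dY.
(* If [v i ** u = v i ** (d ** z)], cancelling [v i] gives [u = d ** z], which lies in [Y]. *)
exists u => // z Xz; rewrite -rngmulA => /(gv i).2 e; apply: nYu.
by rewrite e //; [exact: dY|exact/Y_sub/dY].
Qed.

End RegularMultipliers.

(** * Ring elements coded by tuples *)

Section Coding.
Set Implicit Arguments.
Unset Strict Implicit.
Import GRing.Theory.
Local Open Scope ring_scope.
Variables (L : language) (M : structure L) (A : rngType) (k : nat) (c : A -> k.-tuple M).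

Definition coded (S : set A) (e : seq M) : Prop := exists2 x, S x & e = c x.

Definition coded_graph (op : A -> A -> A) (Z : set A) (e : seq M) : Prop :=
  exists u v, [/\ Z u, Z v & e = c u ++ c v ++ c (op u v)].

Lemma definable_subsetP S : definable_subset c S <-> definable_pred k (coded S).
Proof.
apply: definableP => a; split=> [[x Sx <-]|[x Sx e]]; first by exists x.
by exists x => //; apply: val_inj.
Qed.

Lemma definable_op_onP op Z :
  definable_op_on c op Z <-> definable_pred (k + (k + k)) (coded_graph op Z).
Proof.
apply: definableP => a; split=> [[u Zu [v Zv <-]]|[u [v [Zu Zv e]]]].
  by exists u, v.
by exists u => //; exists v => //; apply: val_inj.
Qed.

Lemma eq_cat_tuple m (a b : k.-tuple M) (s t : m.-tuple M) :
  a ++ s = b ++ t :> seq M -> a = b /\ s = t.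
Proof.
move=> e; have := congr1 (take k) e; have := congr1 (drop k) e.
by rewrite !take_size_cat ?drop_size_cat ?size_tuple // => /val_inj -> /val_inj ->.
Qed.

End Coding.

(** * Definability of zero divisors and of multiples *)

Section Definability.
Set Implicit Arguments.
Unset Strict Implicit.
Import GRing.Theory.
Local Open Scope ring_scope.
Variables (L : language) (M : structure L) (A : rngType) (k : nat) (c : A -> k.-tuple M).
Variable X : set A.
Hypotheses (symX : add_symmetric X) (defX : definable_in c X).

Let c_inj x y : ring_span X x -> ring_span X y -> c x = c y -> x = y.
Proof. by case: defX => inj _ _ _ Sx Sy; apply: inj; rewrite inE. Qed.

Lemma coded_graphP n (op : A -> A -> A) (a b d : k.-tuple M) :
  coded_graph c op (ring_layer X n) (a ++ b ++ d) <->
  exists u v, [/\ ring_layer X n u, ring_layer X n v, a = c u, b = c v & d = c (op u v)].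
Proof.
split=> [[u [v [Xu Xv]]]|[u [v [Xu Xv -> -> ->]]]]; last by exists u, v.
move=> /(@eq_cat_tuple _ _ _ _ _ _ [tuple of b ++ d] [tuple of c v ++ c (op u v)]).
by move=> [-> /(congr1 val) /eq_cat_tuple[-> ->]]; exists u, v.
Qed.

(** Zero is the only solution of [u + u = u], so the graph of addition alone recognizes its code. *)
Lemma coded_zeroP n (a : k.-tuple M) :
  coded_graph c +%R (ring_layer X n) (a ++ a ++ a) <-> a = c 0.
Proof.
have X0 := layer0 symX n.
split=> [/coded_graphP [u [v [Xu Xv au av auv]]]|->]; last first.
  by apply/coded_graphP; exists 0, 0; rewrite addr0.
have uv : u = v by apply: c_inj; rewrite -?au //; [exact: span_layer Xu|exact: span_layer Xv].
suff -> : 0 = u by [].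
have Xuu := layerD symX Xu Xu.
apply: (addrI u); rewrite addr0; apply: c_inj; [exact: span_layer Xu|exact: span_layer Xuu|].
by rewrite {3}uv -auv.
Qed.

(** A sequence of length [m * k] is read as [m] blocks, from which [s1], [s2], [s3] select the
    arguments and the value. The equation on [p] admits lengths such as [k + (k + k)] without
    casts. *)
Lemma definable_graph_select n (x0 : M) (op : A -> A -> A) s1 s2 s3 m p :
  p = (m * k)%N -> (s1 < m)%N -> (s2 < m)%N -> (s3 < m)%N -> definable_op_on c op (ring_layer X n) ->
  definable_pred p (fun e => coded_graph c op (ring_layer X n)
    [seq nth x0 e i | i <- iota (s1 * k) k ++ iota (s2 * k) k ++ iota (s3 * k) k]).
Proof.
move=> -> l1 l2 l3 /definable_op_onP; apply: definable_pred_map.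
  by rewrite !size_cat !size_iota.
have le s : (s < m)%N -> all (fun i => i < m * k)%N (iota (s * k) k).
  move=> lt_s; apply/allP => i; rewrite mem_iota => /andP[_ lt_i].
  by apply: leq_trans lt_i _; rewrite -mulSnr leq_mul2r lt_s orbT.
by rewrite !all_cat !le.
Qed.

Lemma map_nth_iota_fst (x0 : M) (a : k.-tuple M) s :
  [seq nth x0 (a ++ s) i | i <- iota 0 k] = a.
Proof.
by rewrite map_nth_iota0 ?take_size_cat ?size_cat ?size_tuple ?leq_addr.
Qed.

Lemma map_nth_iota_shift (x0 : M) (a : k.-tuple M) s m l :
  [seq nth x0 (a ++ s) i | i <- iota (m.+1 * k) l] = [seq nth x0 s i | i <- iota (m * k) l].
Proof.
rewrite mulSn iotaDl -map_comp; apply: eq_map => i /=.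
by rewrite nth_cat size_tuple ltnNge leq_addr /= addKn.
Qed.

Lemma map_nth_blocks (x0 : M) (x y z : k.-tuple M) :
  [/\ [seq nth x0 (x ++ y ++ z) i | i <- iota (0 * k) k] = x,
      [seq nth x0 (x ++ y ++ z) i | i <- iota (1 * k) k] = y &
      [seq nth x0 (x ++ y ++ z) i | i <- iota (2 * k) k] = z].
Proof.
rewrite !map_nth_iota_shift; split; [exact: map_nth_iota_fst..|].
by have := map_nth_iota_fst x0 z [::]; rewrite cats0.
Qed.

Lemma definable_layer_zero_divisors n : definable_subset c (layer_zero_divisors X n).
Proof.
case: defX => _ defL defD defM; case: (dom_inhabited M) => x0.
have k3 : (k + (k + k) = 3 * k)%N by rewrite !mulSn addn0.
have dG := @definable_graph_select n.+1 x0.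
apply/definable_subsetP.
(* Blocks [0], [1], [2] hold [x], [z], [a], the innermost quantified tuple coming first. The formula
   says that [x + x = x] fails, [z + z = z] and [a ** x = z], read in the graphs on the layer
   [n.+1]. *)
have := definable_pred_and ((definable_subsetP _ _).1 (defL 1%N))
  (definable_pred_ex (definable_pred_ex (definable_pred_and
    (definable_pred_not (dG _ 0%N 0%N 0%N 3%N _ k3 isT isT isT (defD n.+1)))
    (definable_pred_and (dG _ 1%N 1%N 1%N 3%N _ k3 isT isT isT (defD n.+1))
      (dG _ 2%N 0%N 1%N 3%N _ k3 isT isT isT (defM n.+1)))))).
apply: definable_pred_ext => a.
split=> [[[d X1d ad] [z [x]]]|[d [X1d [x [Xx x_neq0 dx0]]] ad]].
  have [E1 E2 E3] := map_nth_blocks x0 x z a; rewrite !map_cat E1 E2 E3 !coded_zeroP //.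
  move=> [nx0 [-> /coded_graphP [d' [y [Xd' Xy ad' xy /esym dy0]]]]].
  have dd' : d' = d.
    by apply: c_inj; [exact: span_layer Xd'|exact: span_layer X1d|rewrite -ad'; exact: val_inj].
  exists d => //; split=> //; exists y; split=> //; first by move=> y0; rewrite xy y0 in nx0.
  rewrite -dd'; apply: c_inj dy0; last exact: span_layer (layer0 symX 0).
  exact: span_layer (layerM symX Xd' Xy).
split; first by exists d.
exists (c 0), (c x); have [E1 E2 E3] := map_nth_blocks x0 (c x) (c 0) a.
rewrite !map_cat E1 E2 E3 !coded_zeroP //; split.
  move=> e; apply: x_neq0; apply: c_inj e; first exact: span_layer Xx.
  exact: span_layer (layer0 symX 0).
split=> //; rewrite ad; apply/coded_graphP; exists d, x; rewrite dx0; split=> //.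
exact: (layer_le symX _ X1d).
Qed.

(** The coded multiples of [X_n] by [v i] are the fibers over [c (v i)] of one predicate, since all
    [v i] lie in the layer on which the graph of multiplication is taken. *)
Lemma SOP_of_decreasing_multiples n (v : nat -> A) :
  (forall i, [/\ ring_layer X n (v i),
      forall z, ring_layer X n z ->
        exists2 z', ring_layer X n z' & rngmul (v i.+1) z = rngmul (v i) z'
    & exists2 z, ring_layer X n z &
        forall z', ring_layer X n z' -> rngmul (v i) z <> rngmul (v i.+1) z']) ->
  SOP (Th M).
Proof.
move=> Hv; case: defX => _ _ _ defM; case: (dom_inhabited M) => x0.
have k3 : (k + (k + k) = 3 * k)%N by rewrite !mulSn addn0.
have dG := @definable_graph_select n x0 _ 2%N 0%N 1%N 3%N _ k3 isT isT isT (defM n).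
have fiber i (x : k.-tuple M) :
    (exists z : k.-tuple M, coded_graph c (@rngmul A) (ring_layer X n)
      [seq nth x0 (z ++ x ++ c (v i)) j
         | j <- iota (2 * k) k ++ iota (0 * k) k ++ iota (1 * k) k]) <->
    exists2 z, ring_layer X n z & x = c (rngmul (v i) z).
  have [Xvi _ _] := Hv i; split=> [[z]|[z Xz ->]].
    have [E1 E2 E3] := map_nth_blocks x0 z x (c (v i)); rewrite !map_cat E1 E2 E3.
    move=> /coded_graphP [w [y [Xw Xy wvi _ xwy]]]; exists y => //.
    by rewrite xwy (c_inj (span_layer Xvi) (span_layer Xw) wvi).
  exists (c z); have [E1 E2 E3] := map_nth_blocks x0 (c z) (c (rngmul (v i) z)) (c (v i)).
  by rewrite !map_cat E1 E2 E3; apply/coded_graphP; exists (v i), z.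
apply: (SOP_of_decreasing_fibers (v := c \o v) (definable_pred_ex dG)) => i /=.
  move=> x /fiber [z Xz ->]; apply/fiber; have [_ sub _] := Hv i.
  by have [z' Xz' ->] := sub z Xz; exists z'.
have [Xvi _ [z Xz nz]] := Hv i; have [Xvi1 _ _] := Hv i.+1.
exists (c (rngmul (v i) z)); first by apply/fiber; exists z.
move=> /fiber [z' Xz' /c_inj e]; apply: (nz z' Xz'); apply: e.
  exact: span_layer (layerM symX Xvi Xz).
exact: span_layer (layerM symX Xvi1 Xz').
Qed.

End Definability.

(** * The dichotomy for [Y] *)

Theorem theorem1p11 (K : nat) (L : language) (M : structure L) (A : rngType)
    (X : set A) (k : nat) (c : A -> k.-tuple M) :
  approximate_subring K X ->
  definable_in c X ->
  NSOP (Th M) ->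
  let Y := setadd (nsum 4 X) (setmul X (nsum 4 X)) in
  (exists D : set A,
     [/\ definable_subset c D, thick D Y
       & forall d, D d -> zero_divisor (ring_span X) d])
  \/ (is_subring Y /\ commensurable (K ^ 11)%N Y X).
Proof.
move=> appX defX nsop Y.
have [symX cov] := appX; have covX := finitely_covered_of_translates cov.
have [YX|] := pselect (forall n, (4 <= n)%N -> ring_layer X n `<=` Y).
  right; split; last exact: target_commensurable.
  have Y4 := target_layer4 symX; split.
  - exact: YX (layer0 symX 4).
  (* Elements of [Y] are in [X_4], so their differences and products fall in [X_5], which is
     contained in [Y] in this case. *)
  - by move=> x y /Y4 Xx /Y4 Xy; apply: (YX 5) => //; exact: layerB.
  - by move=> x y /Y4 Xx /Y4 Xy; apply: (YX 5) => //; exact: layerM.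
move=> /existsNP [n /not_implyP [n_ge4 /existsNP [u /not_implyP [Xu nYu]]]]; left.
exists (layer_zero_divisors X n); split.
- exact: definable_layer_zero_divisors.
- apply: contrapT => not_thick; apply: nsop.
  have [v Hv] := decreasing_multiples symX covX n_ge4 Xu nYu not_thick.
  exact: (SOP_of_decreasing_multiples symX defX (v := v) Hv).
move=> d [X1d [x [Xx x_neq0 dx0]]]; split; first exact: span_layer X1d.
by exists x; split=> //; [exact: span_layer Xx|left].
Qed.
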